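(* Let $n$ be a positive integer. The number $n!$ is a $3$-layered number if and only if $n\ge 5$ and $n\ne 10$.
   Context: A positive integer $N$ is $3$-layered if the set of all positive divisors of $N$ can be partitioned into $3$ subsets having the same sum of elements. *)

(* Defs.v *)
From mathcomp Require Import all_boot.

Set Implicit Arguments.
Unset Strict Implicit.
Unset Printing Implicit Defensive.

(* For 0 < N this is the set of positive divisors: 0 does not divide N, and
   every divisor is at most N. *)
Definition divisor_set (N : nat) : {set 'I_N.+1} := [set d : 'I_N.+1 | d %| N].

(* [partition] requires nonempty blocks; this is no restriction, since the
   divisors of N > 0 have positive sum, so parts with equal sums are nonempty. *)
Definition three_layered (N : nat) : Prop :=
  0 < N /\
  exists P : {set {set 'I_N.+1}},
    [/\ partition P (divisor_set N), #|P| = 3 &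
        forall A B : {set 'I_N.+1}, A \in P -> B \in P ->
          \sum_(d in A) (d : nat) = \sum_(d in B) (d : nat)].

(* Main.v *)
Require Import Defs.
From mathcomp Require Import all_boot.
From mathcomp Require Import zify.

(* For n >= 7 the divisors of N = n! are so dense that the only obstruction is
   3 | sigma(N): handing out the divisors in decreasing order, each to the part
   with the largest remaining capacity, never gets stuck before the divisors
   1, ..., 8 are left, and these can be distributed whatever the three remaining
   capacities are, as long as each is at least 3.  The density needed,
   sum_{d | M, d <= x} d >= 2(x+1) + 9 for 8 <= x <= M, passes from M to qM
   whenever 8q <= M, so it follows from the case 6! = 720.

   3 | sigma(n!) holds as soon as some prime p = 2 mod 3 has odd exponent in n!.
   Let A and B be the products of the m <= n with m = 1 and m = 2 mod 3; thus
   A <= nB.  If all primes p = 2 mod 3 had even exponent in n!, then comparing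
   exponents (in the spirit of Erdos' proof of Bertrand's postulate in the
   progressions mod 3) gives, up to primes below sqrt n,
     n! B | A ((n/2)!)^2 prod_{p <= n/3} p,
   so that roughly 2^n <= 4^(n/3), which is absurd for n >= 2^13.  Smaller n are
   covered by a chain of primes, each less than twice the previous one. *)

Set Implicit Arguments.
Unset Strict Implicit.
Unset Printing Implicit Defensive.

(** * Density of divisors and the greedy distribution *)

Definition sigma_upto (N x : nat) : nat := \sum_(1 <= d < x.+1 | d %| N) d.

Definition sigma (N : nat) : nat := sigma_upto N N.

Lemma sigma_uptoS (N x : nat) :
  sigma_upto N x.+1 = sigma_upto N x + (x.+1 %| N) * x.+1.
Proof.
rewrite /sigma_upto !(big_mkcond (fun d => d %| N)) big_nat_recr //=.
by case: (_ %| N); rewrite ?mul1n.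
Qed.

Lemma sigma_upto0 (N : nat) : sigma_upto N 0 = 0.
Proof. by rewrite /sigma_upto big_geq. Qed.

Lemma leq_sigma_upto (N x y : nat) : x <= y -> sigma_upto N x <= sigma_upto N y.
Proof.
move=> /subnKC <-; elim: (y - x) => [|k IHk]; first by rewrite addn0.
by rewrite addnS sigma_uptoS (leq_trans IHk) ?leq_addr.
Qed.

(** The map d -> qd sends divisors of M up to y to divisors of qM up to qy. *)
Lemma sigma_upto_mul (q M y : nat) : 0 < q ->
  q * sigma_upto M y <= sigma_upto (q * M) (q * y).
Proof.
move=> q0; elim: y => [|y IHy]; first by rewrite sigma_upto0 muln0.
have E : q * y.+1 = (q * y + q.-1).+1 by nia.
rewrite E !sigma_uptoS -E dvdn_pmul2l // mulnDr leq_add //.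
  by apply: leq_trans IHy (leq_sigma_upto _ _); lia.
by rewrite mulnCA.
Qed.

(* The slack 9 = 3 * 3 keeps every capacity at least 3 in [greedy_split]. *)
Definition divisor_rich (M : nat) : Prop :=
  forall x, 8 <= x <= M -> 2 * x.+1 + 9 <= sigma_upto M x.

(** For x <= M the divisors of M suffice. For x > M the bound for M at y = x %/ q, multiplied by q,
    gives it, since q(y + 1) >= x + 1; the hypothesis 8q <= M ensures y >= 8. *)
Lemma divisor_rich_mul (q M : nat) : 0 < q -> 8 * q <= M ->
  divisor_rich M -> divisor_rich (q * M).
Proof.
move=> q0 leqM richM x /andP[x8 xM].
have [lexM|ltMx] := leqP x M.
  have /leq_trans -> // : 2 * x.+1 + 9 <= sigma_upto M x by apply: richM; lia.
  rewrite /sigma_upto big_mkcond [X in _ <= X]big_mkcond leq_sum // => d _.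
  by case: ifP => // dM; rewrite dvdn_mull.
have le_mod := divn_eq x q; have lt_mod := ltn_pmod x q0.
set y := x %/ q in le_mod *.
have y8 : 8 <= y by nia.
have yM : y <= M by nia.
have := richM y; rewrite y8 yM => /(_ isT) rich_y.
have /leq_trans -> // : 2 * x.+1 + 9 <= q * sigma_upto M y by nia.
apply: leq_trans (sigma_upto_mul M y q0) (leq_sigma_upto _ _); lia.
Qed.

(** One pass over k consecutive values from x on, with [acc] carrying [sigma_upto M x]. *)
Fixpoint rich_check (M x k acc : nat) : bool :=
  if k is k'.+1 then
    (2 * x.+1 + 9 <= acc) && rich_check M x.+1 k' (acc + (x.+1 %| M) * x.+1)
  else true.

Lemma rich_checkP (M x k : nat) : rich_check M x k (sigma_upto M x) ->
  forall y, x <= y < x + k -> 2 * y.+1 + 9 <= sigma_upto M y.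
Proof.
elim: k x => [|k IHk] x /=; first by move=> _ y; lia.
rewrite -sigma_uptoS => /andP[rich_x /IHk rich_k] y xy.
by have [->|nyx] := eqVneq y x; last apply: rich_k; lia.
Qed.

Lemma divisor_rich720 : divisor_rich 720.
Proof.
move=> x x8; apply: (@rich_checkP 720 8 713); last lia.
have -> : sigma_upto 720 8 = 29 by rewrite !sigma_uptoS sigma_upto0; vm_compute.
by vm_compute.
Qed.

Lemma divisor_rich_fact (n : nat) : 6 <= n -> divisor_rich n`!.
Proof.
move=> /subnKC <-; elim: (n - 6) => [|k IHk]; first exact: divisor_rich720.
rewrite addnS factS; apply: divisor_rich_mul IHk => //.
have: 8 * (6 + k).+1 <= (6 + k)`!; last by [].
elim: k => [|k IHk] //; rewrite addnS factS; nia.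
Qed.

(** The values of t are the capacities still to be filled exactly by the divisors up to x. *)
Definition splits (N x : nat) (t : 'I_3 -> nat) : Prop :=
  exists col : nat -> 'I_3,
    forall i, \sum_(1 <= d < x.+1 | (d %| N) && (col d == i)) d = t i.

Lemma splits_skip (N x : nat) (t : 'I_3 -> nat) :
  ~~ (x.+1 %| N) -> splits N x t -> splits N x.+1 t.
Proof.
move=> /negbTE xN [col colE]; exists col => i.
by rewrite big_mkcond big_nat_recr //= xN addn0 -big_mkcond.
Qed.

Lemma splits_add (N x : nat) (t t' : 'I_3 -> nat) (i : 'I_3) :
  x.+1 %| N -> (forall j, t j = t' j + (i == j) * x.+1) ->
  splits N x t' -> splits N x.+1 t.
Proof.
move=> xN tE [col colE]; exists (fun d => if d == x.+1 then i else col d) => j.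
rewrite big_mkcond big_nat_recr //= eqxx xN tE -colE [in RHS]big_mkcond /=.
congr (_ + _); last by case: (i == j); rewrite ?mul1n.
by apply: eq_big_nat => d /andP[_ dx]; rewrite (_ : d == x.+1 = false) //; lia.
Qed.

Lemma greedy_split (N x : nat) (t : 'I_3 -> nat) : divisor_rich N ->
  (forall t' : 'I_3 -> nat, (forall i, 3 <= t' i) ->
     \sum_i t' i = sigma_upto N 8 -> splits N 8 t') ->
  8 <= x <= N -> (forall i, 3 <= t i) -> \sum_i t i = sigma_upto N x ->
  splits N x t.
Proof.
move=> richN base /andP[/subnKC <-]; elim: (x - 8) t => [|k IHk] t.
  by rewrite addn0 => _; apply: base.
rewrite addnS => ltN t3; rewrite sigma_uptoS => tE.
have [dN|dN] := boolP ((8 + k).+1 %| N); last first.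
  by apply: splits_skip => //; apply: IHk => //; [lia|rewrite tE (negbTE dN) addn0].
have rich_k : 2 * (8 + k).+1 + 9 <= sigma_upto N (8 + k) by apply: richN; lia.
rewrite dN mul1n in tE.
(* Pigeonhole: by richness the capacities add up to at least 3((8 + k).+1 + 3). *)
have [i ti] : exists i, (8 + k).+1 + 3 <= t i.
  apply/existsP; apply: contraT; rewrite negb_exists => /forallP small.
  have := small ord0; have := small (lift ord0 ord0).
  have := small (lift ord0 (lift ord0 ord0)).
  move: tE; rewrite !big_ord_recl big_ord0; lia.
apply: (@splits_add _ _ _ (fun j => t j - (i == j) * (8 + k).+1) i) => //.
- by move=> j; case: eqVneq => [<-|]; lia.
- apply: IHk; first by lia.
  + by move=> j; case: eqVneq => [<-|_]; have := t3 j; lia.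
  + have : \sum_j t j = \sum_j (t j - (i == j) * (8 + k).+1) +
                          \sum_j (i == j) * (8 + k).+1.
      by rewrite -big_split; apply: eq_bigr => j _ /=; case: eqVneq => [<-|]; lia.
    have -> : \sum_j (i == j) * (8 + k).+1 = (8 + k).+1.
      rewrite (bigD1 i) //= eqxx big1 ?addn0 ?mul1n // => j.
      by rewrite eq_sym => /negbTE ->.
    by lia.
Qed.

(** Exhaustive search for a distribution of 1, ..., x into parts with sums a, b, c. *)
Fixpoint fillable (x a b c : nat) : bool :=
  if x is y.+1 then
    [|| (x <= a) && fillable y (a - x) b c,
        (x <= b) && fillable y a (b - x) c |
        (x <= c) && fillable y a b (c - x)]
  else [&& a == 0, b == 0 & c == 0].

Lemma fillable_splits (N x a b c : nat) (t : 'I_3 -> nat) :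
  (forall d, 0 < d <= x -> d %| N) ->
  (forall i, t i = nth 0 [:: a; b; c] i) ->
  fillable x a b c -> splits N x t.
Proof.
elim: x a b c t => [|x IHx] a b c t dN tE /=.
  case/and3P=> /eqP a0 /eqP b0 /eqP c0; exists (fun _ => ord0) => i.
  by rewrite big_geq // tE a0 b0 c0; case: i => [[|[|[|]]]].
have dN' d : 0 < d <= x -> d %| N by move=> dx; apply: dN; lia.
have xN : x.+1 %| N by apply: dN; lia.
have three (j : 'I_3) : [\/ j = 0 :> nat, j = 1 :> nat | j = 2 :> nat].
  by case: j => [[|[|[|]]]] //= _; [constructor 1|constructor 2|constructor 3].
case/or3P=> /andP[le_x /(IHx _ _ _ (fun j => nth 0 _ (val j)) dN' (fun j => erefl))].
- apply: (splits_add (i := @Ordinal 3 0 isT) xN) => j; rewrite tE.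
  by rewrite -val_eqE /=; case: (three j) => -> /=; lia.
- apply: (splits_add (i := @Ordinal 3 1 isT) xN) => j; rewrite tE.
  by rewrite -val_eqE /=; case: (three j) => -> /=; lia.
- apply: (splits_add (i := @Ordinal 3 2 isT) xN) => j; rewrite tE.
  by rewrite -val_eqE /=; case: (three j) => -> /=; lia.
Qed.

Lemma splits8 (N : nat) (t : 'I_3 -> nat) :
  (forall d, 0 < d <= 8 -> d %| N) -> (forall i, 3 <= t i) ->
  \sum_i t i = sigma_upto N 8 -> splits N 8 t.
Proof.
move=> dN t3; have -> : sigma_upto N 8 = 36.
  by rewrite !sigma_uptoS sigma_upto0 !dN.
rewrite !big_ord_recl big_ord0.
set i0 := ord0; set i1 := lift _ _; set i2 := lift _ _ => tE.
(* All a, b >= 3 whose complement to 36 = 1 + ... + 8 is also at least 3: a <= 30 and b <= 33 -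
   a. *)
have check : all (fun a => all (fun b => fillable 8 a b (36 - (a + b)))
                            (iota 3 (31 - a))) (iota 3 28) by vm_compute.
have [g0 g1 g2] : [/\ 3 <= t i0, 3 <= t i1 & 3 <= t i2] by split; apply: t3.
apply: (@fillable_splits _ _ (t i0) (t i1) (t i2)) => //.
  move=> i; case: i => [[|[|[|]]]] //= lt3; congr t; exact/val_inj.
have /allP/(_ (t i0)) := check; rewrite mem_iota => /(_ ltac:(lia)) /allP/(_ (t i1)).
rewrite mem_iota => /(_ ltac:(lia)); congr fillable; lia.
Qed.

(** * Colourings of divisors and partitions into three blocks *)

Lemma sum_divisor_set (N : nat) (P : pred nat) :
  \sum_(d in divisor_set N | P (d : nat)) (d : nat) =
  \sum_(1 <= d < N.+1 | (d %| N) && P d) d.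
Proof.
transitivity (\sum_(0 <= d < N.+1 | (d %| N) && P d) d).
  by rewrite big_mkord; apply: eq_bigl => d; rewrite inE.
by rewrite big_mkcond big_ltn // -big_mkcond; case: ifP.
Qed.

Lemma sigma_divisor_set (N : nat) : \sum_(d in divisor_set N) (d : nat) = sigma N.
Proof.
rewrite /sigma /sigma_upto -(eq_bigl _ _ (fun d => andbT (d %| N))).
rewrite -(sum_divisor_set N xpredT); apply: eq_bigl => d; exact/esym/andbT.
Qed.

Lemma splits_three_layered (N T : nat) :
  0 < N -> 0 < T -> splits N N (fun=> T) -> three_layered N.
Proof.
move=> N0 T0 [col colE]; split=> //.
pose block i := [set d in divisor_set N | col (val d) == i].
have sum_block i : \sum_(d in block i) (d : nat) = T.
  rewrite -(colE i) -(sum_divisor_set N (fun d => col d == i)).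
  by apply: eq_bigl => d; rewrite !inE.
have block_n0 i : exists d, d \in block i.
  (* A positive common sum makes the blocks nonempty, hence distinct, so that there are exactly
     three. *)
  apply/set0Pn/eqP => block0; have := sum_block i.
  by rewrite block0 big_set0 => T0'; rewrite -T0' in T0.
have block_inj : injective block.
  move=> i j eq_ij; have [d di] := block_n0 i; have := di; rewrite eq_ij.
  by move: di; rewrite !inE => /andP[_ /eqP <-] /andP[_ /eqP].
exists (block @: [set: 'I_3]); split; last 2 first.
- by rewrite card_imset // cardsT card_ord.
- by move=> A B /imsetP[i _ ->] /imsetP[j _ ->]; rewrite !sum_block.
apply/and3P; split.
- apply/eqP/setP => d; apply/bigcupP/idP => [[A /imsetP[i _ ->]]|dN].
    by rewrite inE => /andP[].
  exists (block (col (val d))); first by rewrite imset_f ?inE.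
  by rewrite inE dN eqxx.
- apply/trivIsetP => A B /imsetP[i _ ->] /imsetP[j _ ->] neq_ij.
  rewrite -setI_eq0; apply/eqP/setP => d; rewrite !inE.
  apply/negbTE; apply: contra neq_ij => /andP[/andP[_ /eqP <-] /andP[_ /eqP <-]].
  exact: eqxx.
- by apply/imsetP => -[i _ /esym b0]; have [d] := block_n0 i; rewrite b0 inE.
Qed.

(** The divisor sum is three times the common block sum, and the block containing N has sum at least
    N. The two conclusions exclude n = 10 and n <= 4 respectively. *)
Lemma three_layered_sigma (N : nat) : three_layered N ->
  3 %| sigma N /\ 3 * N <= sigma N.
Proof.
move=> [N0 [P [partP cardP eq_sums]]].
have /and3P[/eqP coverP trivP _] := partP.
have NN : (ord_max : 'I_N.+1) \in divisor_set N by rewrite inE dvdnn.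
move: (NN); rewrite -coverP => /bigcupP[A AP NA].
have -> : sigma N = 3 * \sum_(d in A) (d : nat).
  rewrite -sigma_divisor_set -coverP big_trivIset //= -cardP -sum_nat_const.
  by apply: eq_bigr => B BP; apply: eq_sums.
split; first exact: dvdn_mulr.
by rewrite leq_mul2l /= (bigD1 ord_max) //= leq_addr.
Qed.

Lemma three_layered_fact7 (n : nat) : 7 <= n -> 3 %| sigma n`! -> three_layered n`!.
Proof.
move=> n7 /dvdnP[T sigmaE].
have n8 : 8 <= n`!.
  exact: leq_trans (_ : 8 <= 7`!) (leq_fact n7).
have rich : divisor_rich n`! by apply: divisor_rich_fact; lia.
(* Richness at x = n! itself makes the common sum T at least 3. *)
have := rich n`!; rewrite n8 leqnn => /(_ isT) T3.
rewrite /sigma in sigmaE.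
apply: (splits_three_layered (fact_gt0 n) (T := T)); first by lia.
apply: greedy_split => //; [|by rewrite n8 /=|by move=> i; lia|].
- move=> t t3; apply: splits8 => // d /andP[d0 d8].
  have [d_n|n_d] := leqP d n; first by rewrite dvdn_fact ?d0.
  (* The one divisor not covered by d <= n: 8 divides 7! = 5040. *)
  by have [-> ->] : n = 7 /\ d = 8 by lia.
- by rewrite sum_nat_const card_ord mulnC.
Qed.

(** * Explicit partitions for 5! and 6!, which 7 does not divide *)

Lemma three_layered_fact5 : three_layered 5`!.
Proof.
(* The divisor sum of 120 is 360 = 3 * 120. *)
apply: (@splits_three_layered _ 120) => //.
exists (fun d => if d == 120 then @Ordinal 3 0 isT
  else if d \in [:: 60; 40; 20] then @Ordinal 3 1 isT else @Ordinal 3 2 isT).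
by case=> [[|[|[|//]]] ?]; rewrite unlock; vm_compute.
Qed.

Lemma three_layered_fact6 : three_layered 6`!.
Proof.
(* The divisor sum of 720 is 2418 = 3 * 806. *)
apply: (@splits_three_layered _ 806) => //.
exists (fun d => if d \in [:: 720; 80; 6] then @Ordinal 3 0 isT
  else if d \in [:: 360; 240; 180; 24; 2] then @Ordinal 3 1 isT
  else @Ordinal 3 2 isT).
by case=> [[|[|[|//]]] ?]; rewrite unlock; vm_compute.
Qed.

(** * Divisibility of the divisor sum by 3 *)

Lemma sigma_divisors (N : nat) : 0 < N -> sigma N = \sum_(d <- divisors N) d.
Proof.
move=> N0; rewrite /sigma /sigma_upto -big_filter; apply: perm_big.
apply: uniq_perm; [exact/filter_uniq/iota_uniq|exact: divisors_uniq|move=> d].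
rewrite mem_filter mem_index_iota -dvdn_divisors //.
case dN: (d %| N) => //=; rewrite ltnS (dvdn_leq N0 dN) andbT.
exact: dvdn_gt0 dN.
Qed.

(** Multiplication is a bijection from pairs of divisors to divisors of mn, with inverse d ->
    (gcd(d, m), gcd(d, n)). *)
Lemma sigmaM (m n : nat) : 0 < m -> 0 < n -> coprime m n ->
  sigma (m * n) = sigma m * sigma n.
Proof.
move=> m0 n0 co_mn; rewrite !sigma_divisors ?muln_gt0 ?m0 //.
rewrite big_distrlr /= -(big_allpairs_dep (h := muln) (F := id)).
apply: perm_big; apply: uniq_perm; first exact: divisors_uniq.
  apply: allpairs_uniq; try exact: divisors_uniq.
  case=> a b [c d] /allpairsP[[a' b'] /= [am bn [-> ->]]].
  case/allpairsP=> [[c' d'] /= [cm dn [-> ->]]].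
  move: am bn cm dn; rewrite -!dvdn_divisors //= => am bn cm dn eq_ab.
  have gcd_l x y : x %| m -> y %| n -> gcdn (x * y) m = x.
    move=> xm yn; rewrite gcdnC Gauss_gcdl; first exact/gcdn_idPr.
    exact: coprime_dvdr yn co_mn.
  have gcd_r x y : x %| m -> y %| n -> gcdn (x * y) n = y.
    move=> xm yn; rewrite gcdnC Gauss_gcdr; first exact/gcdn_idPr.
    by rewrite coprime_sym; apply: coprime_dvdl xm co_mn.
  congr (_, _); first by rewrite -[LHS](gcd_l a' b') // eq_ab gcd_l.
  by rewrite -[LHS](gcd_r a' b') // eq_ab gcd_r.
move=> d; rewrite -dvdn_divisors ?muln_gt0 ?m0 //; apply/idP/allpairsP.
  move=> dmn; exists (gcdn d m, gcdn d n) => /=.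
  rewrite -!dvdn_divisors ?dvdn_gcdr //; split=> //.
  apply/eqP; rewrite eqn_dvd Gauss_dvd ?dvdn_gcdl ?andbT; last first.
    exact: coprime_dvdl (dvdn_gcdr d m) (coprime_dvdr (dvdn_gcdr d n) co_mn).
  by rewrite muln_gcdl !muln_gcdr !dvdn_gcd dmn !(dvdn_mulr _ (dvdnn d)) dvdn_mull.
by case=> -[a b] /= []; rewrite -!dvdn_divisors // => am bn ->; apply: dvdn_mul.
Qed.

Lemma sigma_pfactor (p e : nat) : prime p -> sigma (p ^ e) = \sum_(i < e.+1) p ^ i.
Proof.
move=> pr_p; rewrite sigma_divisors ?expn_gt0 ?prime_gt0 //.
rewrite -(big_mkord xpredT (expn p)) -(big_map (expn p) xpredT id).
apply: perm_big; apply: uniq_perm; first exact: divisors_uniq.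
  by rewrite map_inj_uniq ?iota_uniq // => i j; apply/expnI/prime_gt1.
move=> d; rewrite -dvdn_divisors ?expn_gt0 ?prime_gt0 //.
apply/dvdn_pfactor/mapP => // -[i ie ->]; exists i => //.
  by rewrite mem_index_iota.
by move: ie; rewrite mem_index_iota.
Qed.

(** For odd e the factor 1 + p + ... + p^e of the divisor sum groups into pairs p^(2k) (1 + p), and
    3 divides 1 + p. *)
Lemma dvd3_sigma (p N : nat) : prime p -> p %% 3 = 2 -> 0 < N ->
  odd (logn p N) -> 3 %| sigma N.
Proof.
move=> pr_p p2 N0 odd_v; have [M coM NE] := pfactor_coprime pr_p N0.
have M0 : 0 < M by move: N0; rewrite NE muln_gt0 => /andP[].
rewrite NE sigmaM ?M0 ?expn_gt0 ?(prime_gt0 pr_p) //; last first.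
  by rewrite coprime_sym coprimeXl.
rewrite dvdn_mull // sigma_pfactor //.
have -> : (logn p N).+1 = ((logn p N).+1./2).*2 by lia.
elim: _./2 => [|k IHk]; first by rewrite big_ord0.
rewrite doubleS !big_ord_recr /= -addnA dvdn_add // expnS -mulSn dvdn_mulr //.
by rewrite /dvdn -addn1 -modnDml p2.
Qed.

(** * Products over residue classes modulo 3 *)

Lemma dvdn_logn (m n : nat) : 0 < m -> 0 < n ->
  (forall p, prime p -> logn p m <= logn p n) -> m %| n.
Proof.
move=> m0 n0 le_mn; apply/dvdn_partP => // p.
by rewrite mem_primes => /and3P[pr_p _ _]; rewrite p_part pfactor_dvdn // le_mn.
Qed.

(** * Primorials and central binomial coefficients *)

Definition primorial (m : nat) : nat := \prod_(1 <= p < m.+1 | prime p) p.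

Lemma primorial_gt0 (m : nat) : 0 < primorial m.
Proof. by apply: prodn_cond_gt0 => p; apply: prime_gt0. Qed.

Lemma primorialS (m : nat) :
  primorial m.+1 = primorial m * (if prime m.+1 then m.+1 else 1).
Proof.
rewrite /primorial big_mkcond big_nat_recr //= -big_mkcond.
by case: (prime m.+1).
Qed.

Lemma logn_primorial (p m : nat) : prime p -> logn p (primorial m) = (p <= m).
Proof.
move=> pr_p; elim: m => [|m IHm].
  by rewrite /primorial big_geq // logn1 leqNgt prime_gt0.
rewrite primorialS lognM ?primorial_gt0 ?IHm //; last by case: (prime _).
case: (boolP (prime m.+1)) => [pr_m|npr_m].
  by rewrite logn_prime //; case: eqP => /= ?; lia.
rewrite logn1 addn0; congr nat_of_bool; apply/idP/idP; first by lia.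
by rewrite leq_eqVlt => /predU1P[pm|//]; rewrite -pm pr_p in npr_m.
Qed.

(** The two equal middle coefficients both occur in the expansion of (1 + 1)^(2k+1). *)
Lemma bin_middle_le (k : nat) : 'C(k.*2.+1, k) <= 4 ^ k.
Proof.
have le2 : 'C(k.*2.+1, k).*2 <= 2 ^ k.*2.+1.
  have binE : 'C(k.*2.+1, k) = 'C(k.*2.+1, k.+1).
    by rewrite -bin_sub; [congr 'C(_, _)|]; lia.
  rewrite -addnn {2}binE -[2]/(1 + 1) expnDn.
  rewrite (bigD1 (inord k)) //= (bigD1 (inord k.+1)) /=; last first.
    by rewrite -val_eqE /= !inordK; lia.
  by rewrite !inordK ?exp1n ?muln1; lia.
have -> : 4 ^ k = 2 ^ k.*2 by rewrite -mul2n expnM.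
by move: le2; rewrite expnS; lia.
Qed.

Lemma prime_dvd_fact (p n : nat) : prime p -> (p %| n`!) = (p <= n).
Proof.
move=> pr_p; apply/idP/idP => [|le_pn]; last by rewrite dvdn_fact // prime_gt0.
elim: n => [|n IHn]; first by rewrite dvdn1 => /eqP p1; rewrite p1 in pr_p.
by rewrite factS Euclid_dvdM // => /orP[/dvdn_leq|/IHn]; lia.
Qed.

(* The primes in (k+1, 2k+1] divide the binomial coefficient. *)
Lemma primorial_odd (k : nat) :
  primorial k.*2.+1 <= primorial k.+1 * 'C(k.*2.+1, k).
Proof.
have bin0 : 0 < 'C(k.*2.+1, k) by rewrite bin_gt0; lia.
apply: dvdn_leq; first by rewrite muln_gt0 primorial_gt0.
apply: dvdn_logn => [||p pr_p]; rewrite ?muln_gt0 ?primorial_gt0 //.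
rewrite lognM ?primorial_gt0 // !logn_primorial //.
case: (leqP p k.*2.+1) => //= le_p; case: (leqP p k.+1) => //= lt_p.
rewrite logn_gt0 mem_primes pr_p bin0 /=.
have : p %| (k.*2.+1)`! by rewrite prime_dvd_fact.
rewrite -(bin_fact (_ : k <= k.*2.+1)) ?Euclid_dvdM //; last by lia.
by rewrite !prime_dvd_fact //; case/or3P; lia.
Qed.

Lemma primorial_le (m : nat) : primorial m <= 4 ^ m.
Proof.
elim/ltn_ind: m => -[|[|[|m]]] IH; try by rewrite /primorial unlock.
(* For m odd, m + 3 is even and not prime, so the last factor is 1. Otherwise m + 3 = 2k + 1 with k
   = m/2 + 1, and the primorial of k + 1 is bounded by induction. *)
have [odd_m|even_m] := boolP (odd m).
  rewrite primorialS; case: ifP => [/even_prime[|]|_]; try lia.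
  rewrite muln1; apply: leq_trans (IH _ _) _ => //; rewrite leq_exp2l //.
have -> : m.+3 = (m./2.+1).*2.+1 by lia.
apply: leq_trans (primorial_odd _) _.
have -> : 4 ^ (m./2.+1).*2.+1 = 4 ^ (m./2.+2) * 4 ^ (m./2.+1).
  by rewrite -expnD; congr (4 ^ _); lia.
by rewrite leq_mul ?bin_middle_le // IH; lia.
Qed.

(** A form of 4^m <= (2m + 1) C(2m, m) with m = n/2 rounded down; for odd n the extra factor 2 is at
    most n + 1. *)
Lemma fact_half_lower (n : nat) : 2 ^ n * n./2`! ^ 2 <= n.+1 * n`!.
Proof.
have even_case m : 2 ^ m.*2 * m`! ^ 2 <= (m.*2.+1)`!.
  elim: m => [|m IHm] //; rewrite doubleS !factS !expnS -factS.
  move: IHm; rewrite !factS; set a := 2 ^ _; set f := m`!; set g := (m.*2)`!.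
  set u := a * f ^ 2 => IHm.
  have -> : 2 * (2 * a) * (m.+1 * f * (m.+1 * f * 1)) = u * (4 * m.+1 * m.+1).
    by rewrite /u expnS expn1; nia.
  nia.
have := even_case n./2; have [odd_n|even_n] := boolP (odd n).
  have E : n./2.*2.+1 = n by lia.
  rewrite -[in 2 ^ n]E (expnS 2) E -mulnA => half_le.
  by apply: leq_mul half_le; lia.
have E : n./2.*2 = n by lia.
by rewrite E factS.
Qed.

(** * Prime exponents in the class products A and B *)

Definition class_prod (r n : nat) : nat := \prod_(1 <= m < n.+1 | m %% 3 == r) m.

Definition class_count (r y : nat) : nat := \sum_(1 <= m < y.+1) (m %% 3 == r).

Lemma class_prod_gt0 (r n : nat) : 0 < class_prod r n.
Proof.
rewrite /class_prod big_seq_cond; apply: prodn_cond_gt0 => m.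
by rewrite mem_index_iota => /andP[/andP[]].
Qed.

Lemma class_prodS (r n : nat) :
  class_prod r n.+1 = class_prod r n * (if n.+1 %% 3 == r then n.+1 else 1).
Proof.
rewrite /class_prod big_mkcond big_nat_recr //= -big_mkcond.
by case: eqP.
Qed.

(** Pair 3k + 1 with 3k + 2; an unpaired last factor 3k + 1 equals n. *)
Lemma class_prod_le (n : nat) : 0 < n -> class_prod 1 n <= n * class_prod 2 n.
Proof.
have step k : class_prod 1 (3 * k) <= class_prod 2 (3 * k).
  elim: k => [|k IHk]; first by rewrite /class_prod !big_geq.
  have -> : 3 * k.+1 = (3 * k).+3 by lia.
  rewrite !class_prodS.
  have -> : (3 * k).+1 %% 3 = 1 by lia.
  have -> : (3 * k).+2 %% 3 = 2 by lia.
  have -> : (3 * k).+3 %% 3 = 0 by lia.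
  by rewrite /= !muln1 leq_mul.
have := ltn_pmod n (isT : 0 < 3); have := step (n %/ 3); have := divn_eq n 3.
move: (n %/ 3) (n %% 3) => k r ->; rewrite (mulnC k) => IH.
have e1 : (3 * k).+1 %% 3 = 1 by lia.
have e2 : (3 * k).+2 %% 3 = 2 by lia.
case: r => [|[|[|//]]] _ n0; rewrite ?addn0 ?addn1 ?addn2 in n0 *.
- exact: leq_trans IH (leq_pmull _ n0).
- by rewrite !class_prodS e1 /= muln1 mulnC leq_mul.
- rewrite !class_prodS e1 e2 /= !muln1.
  exact: leq_trans (leq_mul IH (leqnSn _)) (leq_pmull _ _).
Qed.

Lemma logn_class_prod (p r n : nat) : prime p ->
  logn p (class_prod r n) =
  \sum_(1 <= k < n.+1) \sum_(1 <= m < n.+1) ((p ^ k %| m) && (m %% 3 == r)).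
Proof.
move=> pr_p; rewrite exchange_big /=.
have -> : logn p (class_prod r n) = \sum_(1 <= m < n.+1 | m %% 3 == r) logn p m.
  elim: n => [|n IHn]; first by rewrite /class_prod !big_geq ?logn1.
  rewrite class_prodS lognM ?class_prod_gt0 //; last by case: eqP.
  rewrite big_mkcond big_nat_recr //= -big_mkcond IHn.
  by case: eqP; rewrite ?logn1.
rewrite big_mkcond; apply: eq_big_nat => m /andP[m0 mn].
case: eqP => [mr|_]; last by rewrite big1 // => k _; rewrite andbF.
(* The terms with k >= m vanish since p^k > m, so k may range up to n for every m. *)
rewrite logn_count_dvd // [RHS](big_cat_nat m0 (ltnW mn)) /=.
have -> : \sum_(m <= k < n.+1) ((p ^ k %| m) && true) = 0.
  rewrite big_nat_cond big1 // => k; rewrite andbT => /andP[mk _].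
  by rewrite gtnNdvd //; apply: leq_ltn_trans mk (ltn_expl _ (prime_gt1 pr_p)).
by rewrite addn0; apply: eq_bigr => k _; rewrite andbT.
Qed.

Lemma count_multiples (q n : nat) (P : pred nat) : 0 < q ->
  \sum_(1 <= m < n.+1) ((q %| m) && P m) =
  \sum_(1 <= j < (n %/ q).+1) P (q * j).
Proof.
move=> q0; elim: n => [|n IHn]; first by rewrite div0n !big_geq.
rewrite big_nat_recr //= IHn divnS //.
case: (boolP (q %| n.+1)) => [/dvdnP[j jE]|_]; last by rewrite addn0.
rewrite add1n [RHS]big_nat_recr //=; congr (_ + _).
have -> : (n %/ q).+1 = j; last by rewrite jE mulnC.
have := divnS n q0; rewrite jE mulnK // dvdn_mull //; lia.
Qed.

Lemma class_count1 (y : nat) : class_count 1 y = (y + 2) %/ 3.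
Proof.
elim: y => [|y IHy]; first by rewrite /class_count big_geq.
rewrite /class_count big_nat_recr //= -/(class_count 1 y) IHy; lia.
Qed.

Lemma class_count2 (y : nat) : class_count 2 y = (y + 1) %/ 3.
Proof.
elim: y => [|y IHy]; first by rewrite /class_count big_geq.
rewrite /class_count big_nat_recr //= -/(class_count 2 y) IHy; lia.
Qed.

(** Over q = p^k with k >= 1, these counts add up to the exponent of p in [class_prod r n]. *)
Definition class_multiples (r q n : nat) : nat :=
  \sum_(1 <= m < n.+1) ((q %| m) && (m %% 3 == r)).

Lemma class_multiplesE (r q n : nat) : 0 < q ->
  class_multiples r q n = \sum_(1 <= j < (n %/ q).+1) (q * j %% 3 == r).
Proof. exact: count_multiples. Qed.

Lemma class_multiples_mod0 (r q n : nat) : 0 < q -> q %% 3 = 0 -> 0 < r ->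
  class_multiples r q n = 0.
Proof.
move=> q0 q3 r0; rewrite class_multiplesE // big1 // => j _.
by rewrite -modnMml q3 mul0n mod0n; case: r r0.
Qed.

Lemma class_multiples_mod1 (r q n : nat) : q %% 3 = 1 ->
  class_multiples r q n = class_count r (n %/ q).
Proof.
move=> q3; rewrite class_multiplesE; last by case: q q3.
by apply: eq_bigr => j _; rewrite -modnMml q3 mul1n.
Qed.

(** Multiplication by q = 2 mod 3 swaps the classes 1 and 2. *)
Lemma class_multiples_mod2 (q n : nat) : q %% 3 = 2 ->
  class_multiples 1 q n = class_count 2 (n %/ q) /\
  class_multiples 2 q n = class_count 1 (n %/ q).
Proof.
move=> q3; rewrite !class_multiplesE; try by case: q q3.
by split; apply: eq_bigr => j _; rewrite -modnMml q3; congr nat_of_bool; lia.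
Qed.

Lemma divn_half (n q : nat) : n./2 %/ q = (n %/ q)./2.
Proof. by rewrite -!divn2 -!divnMA mulnC. Qed.

(** With y = n %/ q, both y - 2(y/2) and the difference of the class counts are at most 1, and both
    vanish for y = 0. *)
Lemma class_multiples_small (q n : nat) : 0 < q ->
  n %/ q + class_multiples 2 q n <=
  class_multiples 1 q n + 2 * (n./2 %/ q) + 2 * (0 < n %/ q).
Proof.
move=> q0; rewrite divn_half.
have : q %% 3 < 3 by rewrite ltn_pmod.
case qE: (q %% 3) => [|[|[|//]]] _.
- by rewrite !class_multiples_mod0 //; move: (n %/ q) => y; lia.
- by rewrite !class_multiples_mod1 // class_count1 class_count2; move: (n %/ q) => y; lia.
- have [-> ->] := class_multiples_mod2 n qE; rewrite class_count1 class_count2.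
  by move: (n %/ q) => y; lia.
Qed.

(** With y = n %/ q, the excess is at most 1, and 0 for y <= 2. For q = 2 mod 3 this would fail at y
    = 1, which the parity hypothesis excludes. *)
Lemma class_multiples_large (q n : nat) : 0 < q -> q %% 3 != 0 ->
  (q %% 3 = 2 -> ~~ odd (n %/ q)) ->
  n %/ q + class_multiples 2 q n <=
  class_multiples 1 q n + 2 * (n./2 %/ q) + (q <= n %/ 3).
Proof.
move=> q0 q3 even_y; have -> : (q <= n %/ 3) = (3 <= n %/ q).
  by rewrite !leq_divRL // mulnC.
rewrite divn_half; have : q %% 3 < 3 by rewrite ltn_pmod.
case qE: (q %% 3) q3 even_y => [|[|[|//]]] // _ even_y _.
- by rewrite !class_multiples_mod1 // class_count1 class_count2; move: (n %/ q) => y; lia.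
- have := even_y erefl; have [-> ->] := class_multiples_mod2 n qE.
  by rewrite class_count1 class_count2; move: (n %/ q) => y; lia.
Qed.

Lemma logn_fact_wide (p m n : nat) : prime p -> m <= n ->
  logn p m`! = \sum_(1 <= k < n.+1) m %/ p ^ k.
Proof.
move=> pr_p le_mn; rewrite logn_fact //.
rewrite [RHS](big_cat_nat (isT : 1 <= m.+1)) //=.
rewrite [X in _ = _ + X]big_nat_cond [X in _ = _ + X]big1 ?addn0 // => k.
rewrite andbT => /andP[mk _]; apply: divn_small.
exact: ltn_trans mk (ltn_expl _ (prime_gt1 pr_p)).
Qed.

(** Absorbs the excess of the primes p <= s: at most 2 for each k with p^k <= n. *)
Definition small_prime_part (s n : nat) : nat :=
  \prod_(1 <= p < s.+1 | prime p) p ^ (2 * trunc_log p n).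

Lemma small_prime_partS (s n : nat) :
  small_prime_part s.+1 n =
  small_prime_part s n * (if prime s.+1 then s.+1 ^ (2 * trunc_log s.+1 n) else 1).
Proof.
rewrite /small_prime_part big_mkcond big_nat_recr //= -big_mkcond.
by case: (prime s.+1).
Qed.

Lemma small_prime_part_gt0 (s n : nat) : 0 < small_prime_part s n.
Proof. by apply: prodn_cond_gt0 => p pr_p; rewrite expn_gt0 prime_gt0. Qed.

Lemma logn_small_prime_part (p s n : nat) : prime p -> p <= s ->
  2 * trunc_log p n <= logn p (small_prime_part s n).
Proof.
move=> pr_p; elim: s => [|s IHs]; first by rewrite leqNgt prime_gt0.
rewrite small_prime_partS lognM ?small_prime_part_gt0 //; last first.
  by case: ifP => // pr_s; rewrite expn_gt0.
rewrite leq_eqVlt => /predU1P[<-|ps].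
  by rewrite pr_p lognX (logn_prime _ pr_p) eqxx muln1 leq_addl.
exact: leq_trans (IHs ps) (leq_addr _ _).
Qed.

Lemma small_prime_part_le (s n : nat) : 0 < n ->
  small_prime_part s n <= n ^ (2 * s).
Proof.
move=> n0; elim: s => [|s IHs]; first by rewrite /small_prime_part big_geq.
rewrite small_prime_partS mulnSr expnD leq_mul //.
case: ifP => [pr_s|_]; last by rewrite expn_gt0 n0.
by rewrite mulnC expnM leq_exp2r // trunc_logP // prime_gt1.
Qed.

Lemma sum_leq_const (n L : nat) : \sum_(1 <= k < n.+1) (k <= L) <= L.
Proof.
have -> : \sum_(1 <= k < n.+1) (k <= L) = minn n L; last exact: geq_minr.
elim: n => [|n IHn]; first by rewrite big_geq // min0n.
by rewrite big_nat_recr //= IHn; lia.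
Qed.

Lemma logn_class_bound (p s n : nat) : prime p -> 9 <= n -> n < s.+1 ^ 2 ->
  (p %% 3 = 2 -> ~~ odd (logn p n`!)) ->
  logn p n`! + logn p (class_prod 2 n) <=
  logn p (class_prod 1 n) + 2 * logn p n./2`! +
    (logn p (primorial (n %/ 3)) + logn p (small_prime_part s n)).
Proof.
move=> pr_p n9 ltns even_v; have p1 := prime_gt1 pr_p.
have half_n : n./2 <= n by lia.
have vE : logn p n`! = \sum_(1 <= k < n.+1) n %/ p ^ k by exact: logn_fact_wide.
rewrite !logn_class_prod // (logn_fact_wide pr_p half_n).
have sum_bound (e : nat -> nat) :
    (forall k, 0 < k -> n %/ p ^ k + class_multiples 2 (p ^ k) n <=
       class_multiples 1 (p ^ k) n + 2 * (n./2 %/ p ^ k) + e k) ->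
    logn p n`! + \sum_(1 <= k < n.+1) class_multiples 2 (p ^ k) n <=
    \sum_(1 <= k < n.+1) class_multiples 1 (p ^ k) n +
    2 * (\sum_(1 <= k < n.+1) n./2 %/ p ^ k) + \sum_(1 <= k < n.+1) e k.
  move=> bound; rewrite vE big_distrr /= -!big_split /=.
  by rewrite big_nat [X in _ <= X]big_nat; apply: leq_sum => k /andP[k0 _]; apply: bound.
have pk0 k : 0 < p ^ k by rewrite expn_gt0 prime_gt0.
(* For p <= s the crude bound is used at every k. For p > s one has p^2 > n, so only k = 1 counts, n
   %/ p is the exponent of p in n!, and the excess is absorbed by the primorial. *)
have [le_ps|lt_sp] := leqP p s.
  apply: leq_trans (sum_bound (fun k => 2 * (k <= trunc_log p n)) _) _.
    move=> k _; apply: leq_trans (class_multiples_small n (pk0 k)) _.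
    rewrite leq_add2l leq_mul2l /=; case: posnP => //= y0.
    by rewrite trunc_log_max // -divn_gt0.
  rewrite leq_add2l -big_distrr /=; apply: leq_trans (leq_addl _ _).
  apply: leq_trans (logn_small_prime_part n pr_p le_ps).
  by rewrite leq_mul2l sum_leq_const.
have small_k k : 1 < k -> n %/ p ^ k = 0.
  move=> k1; rewrite divn_small //; apply: leq_trans ltns _.
  by apply: leq_trans (_ : p ^ 2 <= _); rewrite ?leq_exp2r // leq_exp2l.
have v1 : logn p n`! = n %/ p.
  rewrite vE big_ltn ?expn1; last by lia.
  by rewrite big_nat big1 ?addn0 // => k /andP[k1 _]; apply: small_k.
apply: leq_trans (sum_bound (fun k => (k == 1) * (p <= n %/ 3)) _) _; last first.
  rewrite leq_add2l logn_primorial // -big_distrl /=.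
  have -> : \sum_(1 <= i < n.+1) (i == 1) = 1.
    by rewrite big_ltn ?big_nat ?big1 //; [move=> i; lia|lia].
  by rewrite mul1n leq_addr.
move=> k k0; have [->|k1] := eqVneq k 1.
  rewrite expn1 mul1n; apply: class_multiples_large; rewrite ?prime_gt0 -?v1 //.
  (* p = 3 > s would give (s + 1)^2 <= 9 <= n. *)
  apply/negP => p3; have : p == 3.
    have : 3 %| p by [].
    by rewrite dvdn_prime2 // eq_sym.
  by move/eqP => p3'; rewrite p3' in lt_sp; nia.
have y0 : n %/ p ^ k = 0 by apply: small_k; lia.
have := class_multiples_small n (pk0 k); rewrite y0; lia.
Qed.

Lemma central_bound (s n : nat) : 9 <= n -> n < s.+1 ^ 2 ->
  (forall p, prime p -> p %% 3 = 2 -> ~~ odd (logn p n`!)) ->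
  2 ^ n <= n.+1 * n * 4 ^ (n %/ 3) * n ^ (2 * s).
Proof.
move=> n9 ltns even_v; have n0 : 0 < n by lia.
have h0 := fact_gt0 n./2; have f0 := fact_gt0 n.
have A0 := class_prod_gt0 1 n; have B0 := class_prod_gt0 2 n.
have P0 := primorial_gt0 (n %/ 3); have S0 := small_prime_part_gt0 s n.
have : n`! * class_prod 2 n %| class_prod 1 n * n./2`! ^ 2 *
         (primorial (n %/ 3) * small_prime_part s n).
  apply: dvdn_logn => [||p pr_p]; rewrite ?muln_gt0 ?expn_gt0 ?f0 ?A0 ?B0 ?h0 ?P0 ?S0 //.
  rewrite !lognM ?lognX ?muln_gt0 ?expn_gt0 ?A0 ?h0 ?P0 ?S0 // addnn -mul2n.
  by apply: logn_class_bound => // p2; apply: even_v.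
move/dvdn_leq; rewrite !muln_gt0 A0 h0 P0 S0 => /(_ isT) le_prod.
have le_AB := class_prod_le n0.
have le_P := primorial_le (n %/ 3).
have le_S := small_prime_part_le s n0.
have le_F := fact_half_lower n.
have le_fact : n`! <= n * n./2`! ^ 2 * (4 ^ (n %/ 3) * n ^ (2 * s)).
  (* A <= nB lets B cancel. *)
  rewrite -(leq_pmul2r B0); apply: leq_trans le_prod _.
  rewrite -[X in _ <= X]mulnAC [n * _ * _]mulnAC.
  by rewrite !leq_mul.
have h20 : 0 < n./2`! ^ 2 by rewrite expn_gt0 h0.
rewrite -(leq_pmul2r h20); apply: leq_trans le_F _.
apply: leq_trans (leq_mul (leqnn _) le_fact) _.
by move: (n./2`! ^ 2) (4 ^ _) (n ^ _) => h a b; lia.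
Qed.

(** * A prime congruent to 2 modulo 3 with odd exponent in n! *)

Lemma sqrt_exists (n : nat) : exists s, s ^ 2 <= n < s.+1 ^ 2.
Proof.
elim: n => [|n [s /andP[le_s lt_s]]]; first by exists 0.
have [lt_n|ge_n] := ltnP n.+1 (s.+1 ^ 2); first by exists s; lia.
by exists s.+1; nia.
Qed.

Lemma exp2_gt_square (t : nat) : 13 <= t -> 1476 * t.+1 ^ 2 < 40 * 2 ^ t.
Proof.
move=> /subnKC <-; elim: (t - 13) => [|k IHk]; first by rewrite !addn0; lia.
rewrite addnS (expnS 2); move: (2 ^ _) IHk => a; nia.
Qed.

Lemma odd_logn_fact_large (n : nat) : 2 ^ 13 <= n ->
  exists p, [/\ prime p, p %% 3 = 2 & odd (logn p n`!)].
Proof.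
move=> n_big.
have [[p [pr_p pn p2 odd_v]]|none] :
    (exists p, [/\ prime p, p < n.+1, p %% 3 = 2 & odd (logn p n`!)]) \/
    (forall p, prime p -> p %% 3 = 2 -> ~~ odd (logn p n`!)).
  have [/existsP[p /and3P[pr_p /eqP p2 odd_v]]|] :=
      boolP [exists p : 'I_n.+1, [&& prime p, p %% 3 == 2 & odd (logn p n`!)]].
    by left; exists p; split.
  rewrite negb_exists => /forallP none; right=> p pr_p p2.
  have [pn|np] := ltnP p n.+1.
    by have := none (Ordinal pn); rewrite /= pr_p p2 eqxx.
  suff -> : logn p n`! = 0 by [].
  by rewrite lognE prime_dvd_fact // [p <= n]leqNgt np !andbF.
- by exists p.
- have [s /andP[le_s lt_s]] := sqrt_exists n.
  have n9 : 9 <= n by lia.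
  have s90 : 90 <= s by nia.
  have := central_bound n9 lt_s none.
  set t := trunc_log 2 n.
  have n_lt : n < 2 ^ t.+1 by apply: trunc_log_ltn.
  have n_ge : 2 ^ t <= n by rewrite trunc_logP //; clear -n9; lia.
  have t13 : 13 <= t by apply: trunc_log_max.
  have := exp2_gt_square t13.
  move=> lt_sq le_n.
  (* Since n + 1 <= 2^(t+1), all factors become powers of 2 and the exponents can be compared. *)
  have : 2 ^ n <= 2 ^ t.+1 * 2 ^ t.+1 * (2 ^ 2) ^ (n %/ 3) * (2 ^ t.+1) ^ (2 * s).
    apply: leq_trans le_n _; rewrite !leq_mul ?(ltnW n_lt) //.
    by rewrite leq_exp2r ?(ltnW n_lt) // muln_gt0 /=; apply: leq_trans s90.
  rewrite -!expnM -!expnD leq_exp2l // => n_le.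
  have le1 : n <= 6 * t.+1 * s.+1 by clear -n_le; lia.
  have le2 : n ^ 2 <= 36 * t.+1 ^ 2 * s.+1 ^ 2.
    by rewrite -(expnMn 6 _ 2) -expnMn leq_exp2r.
  (* Holds because s >= 90 and s^2 <= n. Then 1476 = 36 * 41 in the next bound, which contradicts
     2^t <= n. *)
  have le3 : 40 * s.+1 ^ 2 <= 41 * n.
    by clear -le_s s90; nia.
  have le4 : 40 * n <= 1476 * t.+1 ^ 2.
    have n0 : 0 < n by clear -n9; lia.
    rewrite -(leq_pmul2r n0); move: (t.+1 ^ 2) (s.+1 ^ 2) le2 le3 => a b le2 le3.
    apply: (@leq_trans (40 * (36 * a * b))); first by clear -le2; lia.
    by have := leq_mul (leqnn (36 * a)) le3; clear; lia.
  by clear -le4 lt_sq n_ge; lia.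
Qed.

(** The exponent is exactly 1: n %/ p = 1 and p^2 > n. *)
Lemma odd_logn_fact_mid (p n : nat) : prime p -> 2 < p -> p <= n < p.*2 ->
  odd (logn p n`!).
Proof.
move=> pr_p p2 /andP[le_p lt_p]; have p0 := prime_gt0 pr_p.
rewrite logn_fact // big_ltn; last by lia.
rewrite expn1 big_nat big1 ?addn0 => [|k /andP[k1 _]].
  by rewrite (_ : n %/ p = 1) //; apply/eqP; rewrite eqn_leq leq_divRL // -ltnS ltn_divLR //; lia.
rewrite divn_small //; apply: leq_trans (_ : p ^ 2 <= _); first by nia.
by rewrite leq_exp2l // prime_gt1.
Qed.

(** The intervals [q, 2q) leave no gap, as each start is at most twice the previous one. *)
Lemma doubling_path (p n : nat) (ps : seq nat) :
  path (fun a b => b <= a.*2) p ps -> p <= n < (last p ps).*2 ->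
  exists2 q, q \in p :: ps & q <= n < q.*2.
Proof.
elim: ps p => [|q ps IHps] p /=; first by exists p; rewrite ?mem_head.
move=> /andP[le_q /IHps{}IHps] /andP[le_p lt_n].
have [lt_np|le_pn] := ltnP n p.*2; first by exists p; rewrite ?mem_head ?le_p.
have [|r rps rn] := IHps; first by rewrite lt_n (leq_trans le_q).
by exists r; rewrite // inE rps orbT.
Qed.

Lemma odd_logn_fact (n : nat) : 11 <= n ->
  exists p, [/\ prime p, p %% 3 = 2 & odd (logn p n`!)].
Proof.
move=> n11; have [/odd_logn_fact_large //|lt_n] := leqP (2 ^ 13) n.
pose ps := [:: 17; 29; 53; 101; 197; 389; 773; 1523; 3041; 6053].
have good : all (fun p => [&& prime p, p %% 3 == 2 & 2 < p]) (11 :: ps).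
  by vm_compute.
have doubling : path (fun a b => b <= a.*2) 11 ps by vm_compute.
have top : 2 ^ 13 <= (last 11 ps).*2 by vm_compute.
have n_range : 11 <= n < (last 11 ps).*2.
  by apply/andP; split; [exact: n11 | exact: leq_trans lt_n top].
have [p ps_p pn] := doubling_path doubling n_range.
have /and3P[pr_p /eqP p2 p_gt2] := allP good p ps_p.
exists p; split; [exact: pr_p | exact: p2 | exact: odd_logn_fact_mid pr_p p_gt2 pn].
Qed.

(** * The divisor sum of n! modulo 3, and the equivalence *)

Lemma dvd3_sigma_fact (n : nat) : 7 <= n -> n <> 10 -> 3 %| sigma n`!.
Proof.
move=> n7 n10; have [n9|n9] := leqP n 9.
  (* For 7 <= n <= 9 the prime 5 has exponent 1. *)
  by apply: (@dvd3_sigma 5) (fact_gt0 n) _ => //; apply: odd_logn_fact_mid => //; lia.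
have [p [pr_p p2 odd_v]] : exists p, [/\ prime p, p %% 3 = 2 & odd (logn p n`!)].
  by apply: odd_logn_fact; lia.
exact: dvd3_sigma pr_p p2 (fact_gt0 n) odd_v.
Qed.

(** The divisor sum is 511 * 121 * 31 * 8, with no factor divisible by 3. *)
Lemma sigma_fact10 : ~~ (3 %| sigma 10`!).
Proof.
have -> : 10`! = 2 ^ 8 * (3 ^ 4 * (5 ^ 2 * 7 ^ 1)).
  by rewrite !factS fact0; lia.
rewrite (@sigmaM (2 ^ 8)) // (@sigmaM (3 ^ 4)) // (@sigmaM (5 ^ 2)) //.
rewrite !sigma_pfactor // !Euclid_dvdM //.
by rewrite !big_ord_recl !big_ord0.
Qed.

Theorem theorem5p15 (n : nat) (hn : 0 < n) :
  three_layered n`! <-> 5 <= n /\ n <> 10.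
Proof.
split=> [/three_layered_sigma[dvd3 le_sigma]|[n5 n10]].
  split=> [|n10]; last by rewrite n10 (negbTE sigma_fact10) in dvd3.
  rewrite leqNgt; apply/negP => n4.
  (* For n = 1, ..., 4 the divisor sums 1, 3, 12, 60 are below 3 n! = 3, 6, 18, 72. *)
  by case: n hn n4 le_sigma {dvd3} => [|[|[|[|[|//]]]]] // _ _; rewrite /sigma /sigma_upto unlock.
have [n7|] := leqP 7 n; first by apply: three_layered_fact7 (dvd3_sigma_fact n7 n10).
case: n n5 {hn n10} => [|[|[|[|[|[|[|]]]]]]] // _ _.
  exact: three_layered_fact5.
exact: three_layered_fact6.
Qed.
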